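(* Fix integers $s\geq 2$, $t\geq 2$ and $k\geq 1$. Then \[ \mathrm{La}(n,K_{s,t},\#P_k)=O\!\left(n\binom{n}{\lfloor n/2\rfloor}\right)=O\!\left(\sqrt{n}\,2^n\right) \] as $n\to\infty$ (with implied constants depending on $s,t,k$).
   Context: $2^{[n]}$ is the Boolean lattice of all subsets of $[n]=\{1,\dots,n\}$ ordered by inclusion. A poset $P$ is a (weak) subposet of a poset $Q$ if there is an injection $f:P\to Q$ such that $p\le_P p'$ implies $f(p)\le_Q f(p')$. A family $\mathcal{F}\subseteq 2^{[n]}$ is $P$-free if $P$ is not a weak subposet of $(\mathcal{F},\subseteq)$. $P_k$ denotes the chain on $k$ elements; a copy of $P_k$ in $\mathcal{F}$ is a chain $F_1\subsetneq\cdots\subsetneq F_k$ of members of $\mathcal{F}$. $\mathrm{La}(n,P,\#Q)$ is the maximum number of copies of $Q$ in a $P$-free family $\mathcal{F}\subseteq 2^{[n]}$. For positive integers $s,t$, the poset $K_{s,t}$ has $s$ minimal elements and $t$ maximal elements, and every minimal element is less than every maximal element. *)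

(* Defs.v *)
From HB Require Import structures.
From mathcomp Require Import all_boot all_order.

Set Implicit Arguments.
Unset Strict Implicit.
Unset Printing Implicit Defensive.

Import Order.Theory.
Local Open Scope order_scope.

Definition weak_subposet (d d' : Order.disp_t) (P : finPOrderType d)
    (Q : finPOrderType d') : bool :=
  [exists f : {ffun P -> Q},
    injectiveb f && [forall x, forall y, (x <= y) ==> (f x <= f y)]].

Lemma weak_subposetP (d d' : Order.disp_t) (P : finPOrderType d)
    (Q : finPOrderType d') :
  reflect (exists2 f : P -> Q, injective f & {homo f : x y / x <= y})
          (weak_subposet P Q).
Proof.
apply: (iffP existsP) => [[f /andP[/injectiveP inj_f /forallP homo_f]]|].
  by exists f => // x y; have /forallP/(_ y)/implyP := homo_f x.
move=> [f inj_f homo_f]; exists [ffun x => f x]; apply/andP; split.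
  by apply/injectiveP => x y; rewrite !ffunE; apply: inj_f.
by apply/forallP => x; apply/forallP => y; apply/implyP; rewrite !ffunE => /homo_f.
Qed.

Fact inclusion_display : Order.disp_t. Proof. exact. Qed.

(* A family F of subsets of [n] (the ground set being 'I_n), seen as the poset
   of its members ordered by inclusion. *)
Definition family_poset (n : nat) (F : {set {set 'I_n}}) : Type :=
  {A : {set 'I_n} | A \in F}.

HB.instance Definition _ (n : nat) (F : {set {set 'I_n}}) :=
  SubFinite.copy (family_poset F) {A : {set 'I_n} | A \in F}.

Definition family_le (n : nat) (F : {set {set 'I_n}}) (A B : family_poset F) :
  bool := val A \subset val B.

Fact family_le_refl (n : nat) (F : {set {set 'I_n}}) :
  reflexive (@family_le n F).
Proof. by move=> A; apply: subxx. Qed.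

Fact family_le_anti (n : nat) (F : {set {set 'I_n}}) :
  antisymmetric (@family_le n F).
Proof. by move=> A B leAB; apply/val_inj/eqP; rewrite eqEsubset. Qed.

Fact family_le_trans (n : nat) (F : {set {set 'I_n}}) :
  transitive (@family_le n F).
Proof. by move=> B A C; apply: subset_trans. Qed.

HB.instance Definition _ (n : nat) (F : {set {set 'I_n}}) :=
  Order.Le_isPOrder.Build inclusion_display (family_poset F)
    (@family_le_refl n F) (@family_le_anti n F) (@family_le_trans n F).

Definition poset_free (d : Order.disp_t) (P : finPOrderType d) (n : nat)
    (F : {set {set 'I_n}}) : bool :=
  ~~ weak_subposet P (family_poset F).

(* Copies of the chain P_k in F: sequences F_1 < ... < F_k of members of F,
   strictly increasing for inclusion. *)
Definition chains (k n : nat) (F : {set {set 'I_n}}) :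
    {set k.-tuple {set 'I_n}} :=
  [set c : k.-tuple {set 'I_n} |
    all [in F] c && sorted (fun A B : {set 'I_n} => A \proper B) c].

(* La(n, P, #P_k) *)
Definition La_chain (d : Order.disp_t) (n : nat) (P : finPOrderType d)
    (k : nat) : nat :=
  (\max_(F : {set {set 'I_n}} | poset_free P F) #|chains k F|)%N.

(* K_{s,t}: the summand 'I_s carries the minimal elements, 'I_t the maximal
   ones. *)
Definition K (s t : nat) : Type := ('I_s + 'I_t)%type.

HB.instance Definition _ (s t : nat) := Finite.copy (K s t) ('I_s + 'I_t)%type.

Definition K_le (s t : nat) (x y : K s t) : bool :=
  (x == y) || (match x, y with inl _, inr _ => true | _, _ => false end).

Fact K_le_refl (s t : nat) : reflexive (@K_le s t).
Proof. by move=> x; rewrite /K_le eqxx. Qed.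

Fact K_le_anti (s t : nat) : antisymmetric (@K_le s t).
Proof.
by move=> [x|x] [y|y]; rewrite /K_le ?orbF => /andP[] // /eqP.
Qed.

Fact K_le_trans (s t : nat) : transitive (@K_le s t).
Proof.
move=> [y|y] [x|x] [z|z]; rewrite /K_le ?orbF ?orbT //.
- by move=> /eqP-> /eqP->.
- by move=> /eqP-> /eqP->.
Qed.

Fact K_display : Order.disp_t. Proof. exact. Qed.

HB.instance Definition _ (s t : nat) :=
  Order.Le_isPOrder.Build K_display (K s t)
    (@K_le_refl s t) (@K_le_anti s t) (@K_le_trans s t).

(* Main.v *)
(** Fix a [K_{s,t}]-free family [F]. Every set [X] has at most [s] members of
    [F] below it ("low") or at most [t] members above it ("high"), for otherwise
    [X] would separate the two sides of a copy of [K_{s,t}]. Low sets form a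
    down-set [L]. A chain of [F] either lies below a low set, or above a set
    outside [L], hence high, or crosses an edge [(X, X + x)] of the cube leaving
    [L], its members being then below [X] or above [X + x]. Each set and each
    such edge thus accounts for at most [(s + t)^k] chains. The number of edges
    leaving a down-set [L] is [\sum_(X in L) (n - 2 |X|)], which is largest when
    [L] consists of the sets of size at most [n/2], and the sum then telescopes
    to at most [n * 'C(n, n./2)]. *)
Require Import Defs.
From mathcomp Require Import all_boot all_order.
From mathcomp Require Import zify.
Set Implicit Arguments.
Unset Strict Implicit.
Unset Printing Implicit Defensive.

(** * Central binomial coefficients against powers of two *)

Lemma mul_central_binS m :
  m.+1 * 'C(m.+1.*2, m.+1) = 2 * m.*2.+1 * 'C(m.*2, m).
Proof.
have h1 := mul_bin_diag m.*2.+2 m.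
have h2 := mul_bin_left m.*2.+1 m.
have h3 := mul_bin_diag m.*2.+1 m.
have h4 := bin_sub (_ : m <= m.*2.+1); rewrite -addnn in h1 h2 h3 h4 *.
have e : (m + m).+1 - m = m.+1 by lia.
rewrite e in h2 h4; rewrite /= in h1 h3.
have -> : m.+1.*2 = (m + m).+2 by lia.
have := h4 ltac:(lia); nia.
Qed.

Lemma central_bin_odd m : 2 * 'C(m.*2.+1, m) = 'C(m.+1.*2, m.+1).
Proof.
have h4 := bin_sub (_ : m <= m.*2.+1).
have e : m.*2.+1 - m = m.+1 by lia.
by rewrite doubleS binS -h4 ?e; lia.
Qed.

(** By [mul_central_binS] each step multiplies the coefficient by [2(2m+1)/(m+1)], and
    [(m+2)(2m+1) >= 2(m+1)^2]. *)
Lemma central_bin_lower m : 4 ^ m <= m.+1 * 'C(m.*2, m).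
Proof.
elim: m => // m IH; have := mul_central_binS m; rewrite expnS.
set c := 'C(_, _) in IH *; set d := 'C(_, _); set p := 4 ^ m in IH * => h.
suff : m.+1 * (4 * p) <= m.+1 * (m.+2 * d) by rewrite leq_pmul2l.
rewrite (mulnCA m.+1 m.+2) h; nia.
Qed.

(** The factor [2m+1] makes the induction close: each step multiplies the left side by
    [4(2m+1)(2m+3)/(m+1)^2], which is at most 16. *)
Lemma central_bin_upper m : m.*2.+1 * 'C(m.*2, m) ^ 2 <= 16 ^ m.
Proof.
elim: m => // m IH; have := mul_central_binS m; rewrite (expnS 16).
set c := 'C(_, _) in IH *; set d := 'C(_, _); set p := 16 ^ m in IH * => h.
have {h} h : m.+1 ^ 2 * d ^ 2 = 4 * m.*2.+1 * (m.*2.+1 * c ^ 2).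
  by rewrite -expnMn h !expnMn; lia.
suff : m.+1 ^ 2 * (m.+1.*2.+1 * d ^ 2) <= m.+1 ^ 2 * (16 * p).
  by rewrite leq_pmul2l ?expn_gt0.
rewrite mulnCA h -addnn; rewrite -addnn in IH.
set q := _ * c ^ 2 in IH *; nia.
Qed.

Lemma expn2_le_bin_half n : 2 ^ n <= n.+1 * 'C(n, n./2).
Proof.
rewrite -{1 2 3}(odd_double_half n); case: (odd n); set m := n./2.
  have := central_bin_lower m.+1; rewrite -central_bin_odd add1n.
  rewrite expnS -(mul2n m) expnS expnM.
  set c := 'C(_, _); set p := _ ^ m; nia.
rewrite add0n -{1}(mul2n m) expnM; apply: leq_trans (central_bin_lower m) _.
by rewrite leq_mul2r; lia.
Qed.

(** Squaring keeps the bound [sqrt n * 'C(n, n./2) <= 2 ^ n] within the naturals; odd [n] is reduced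
    to [n + 1] by [central_bin_odd]. *)
Lemma bin_half_sqr_le n : n * 'C(n, n./2) ^ 2 <= (2 ^ n) ^ 2.
Proof.
rewrite -{1 2 4}(odd_double_half n); case: (odd n); set m := n./2.
  have -> : (2 ^ (true + m.*2)) ^ 2 = 4 * 16 ^ m.
    have e : (true + m.*2) * 2 = 2 + 4 * m by lia.
    by rewrite -expnM e expnD (expnM 2 4).
  have := central_bin_upper m.+1; rewrite -central_bin_odd add1n (expnS 16).
  set c := 'C(_, _); set p := _ ^ m; nia.
have -> : (2 ^ (false + m.*2)) ^ 2 = 16 ^ m.
  have e : (false + m.*2) * 2 = 4 * m by lia.
  by rewrite -expnM e (expnM 2 4).
by apply: leq_trans (central_bin_upper m); rewrite leq_mul2r leqnSn orbT.
Qed.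

(** * Edges of the cube leaving a down-set *)

Lemma sum_cards n (f : nat -> nat) :
  \sum_(X : {set 'I_n}) f #|X| = \sum_(i < n.+1) 'C(n, i) * f i.
Proof.
rewrite (partition_big (fun X : {set 'I_n} => inord #|X| : 'I_n.+1) predT) //=.
apply: eq_bigr => i _.
have := card_draws 'I_n i; rewrite card_ord => <-; rewrite -sum_nat_const.
have cX (X : {set 'I_n}) : #|X| < n.+1 by rewrite ltnS -[leqRHS]card_ord max_card.
apply: eq_big => [X|X /eqP <-]; last by rewrite inordK.
by rewrite inE -val_eqE /= inordK.
Qed.

(** Telescoping: [(i+1) 'C(n, i+1) = (n-i) 'C(n, i)], so each term is the increment of [i 'C(n, i)].
    The hypothesis keeps every subtraction from truncating. *)
Lemma sum_bin_sub n j : j.*2 <= n.+2 ->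
  \sum_(i < j) 'C(n, i) * (n - i.*2) = j * 'C(n, j).
Proof.
elim: j => [|j IH] le_jn; first by rewrite big_ord0.
rewrite big_ord_recr /= IH; last by lia.
by rewrite mul_bin_left (mulnC 'C(_, _)) -mulnDl; congr (_ * _); lia.
Qed.

Definition edge_boundary (n : nat) (L : {set {set 'I_n}}) :
    {set {set 'I_n} * 'I_n} :=
  [set p | [&& p.1 \in L, p.2 \notin p.1 & p.2 |: p.1 \notin L]].

Lemma card_incidences n (L : {set {set 'I_n}}) (N : {set 'I_n} -> {set 'I_n}) :
  #|[set p : {set 'I_n} * 'I_n | (p.1 \in L) && (p.2 \in N p.1)]|
    = \sum_(X in L) #|N X|.
Proof.
rewrite -sum1_card (eq_bigl (fun p => (p.1 \in L) && (p.2 \in N p.1))).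
  by rewrite -(pair_big_dep _ (fun X x => x \in N X) (fun _ _ => 1));
     apply: eq_bigr => X _; rewrite sum1_card.
by move=> p; rewrite inE.
Qed.

(* The cube edges leaving a down-set [L] number exactly
   [\sum_(X in L) (n - 2 |X|)]: every [X] in [L] has [n - |X|] upward edges,
   and all of its [|X|] downward edges stay inside [L]. *)
Lemma edge_boundary_down_set n (L : {set {set 'I_n}}) :
  (forall X Y : {set 'I_n}, X \subset Y -> Y \in L -> X \in L) ->
  #|edge_boundary L| <= n * 'C(n, n./2).
Proof.
move=> downL.
pose up := [set p : {set 'I_n} * 'I_n | (p.1 \in L) && (p.2 \in ~: p.1)].
pose down := [set p : {set 'I_n} * 'I_n | (p.1 \in L) && (p.2 \in p.1)].
(* The same edge, recorded by its lower end instead of its upper end. *)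
pose lower (p : {set 'I_n} * 'I_n) := (p.1 :\ p.2, p.2).
have lower_inj : {in down &, injective lower}.
  move=> [X x] [Y y]; rewrite !inE /= => /andP[_ xX] /andP[_ yY] [eXY exy].
  by rewrite -exy in eXY yY *; rewrite -(setD1K xX) eXY setD1K.
have disj : [disjoint edge_boundary L & lower @: down].
  apply/pred0P => p /=; apply/negP => /andP[] /[swap] /imsetP[[X x]].
  by rewrite !inE /= => /andP[XL xX] -> /=; rewrite setD1K ?XL ?andbF.
have sub : edge_boundary L :|: lower @: down \subset up.
  apply/subsetP => p; rewrite inE => /orP[|/imsetP[[X x]]].
    by rewrite !inE => /and3P[-> -> _].
  rewrite !inE /= => /andP[XL xX] ->; rewrite !inE eqxx andbT.
  by apply: downL XL; apply: subsetDl.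
have := subset_leq_card sub.
rewrite cardsU (disjoint_setI0 disj) cards0 subn0 card_in_imset //.
rewrite (card_incidences L (fun X => ~: X)) (card_incidences L id) => le_up.
(* Truncated subtraction turns the negative terms into 0, so the sum may be extended from [L] to all
   sets. *)
have le_n : \sum_(X in L) #|~: X|
    <= \sum_(X in L) #|X| + \sum_(X : {set 'I_n}) (n - #|X|.*2).
  rewrite [X in _ <= _ + X](bigID (mem L)) /= addnA -big_split /=.
  apply: leq_trans (leq_addr _ _); apply: leq_sum => X _.
  by rewrite -(leq_add2l #|X|) cardsC card_ord; move: #|X| => a; lia.
apply: leq_trans (_ : \sum_(X : {set 'I_n}) (n - #|X|.*2) <= _); first by lia.
rewrite (sum_cards n (fun i => n - i.*2)).
(* Only the levels up to [n./2] contribute; [sum_bin_sub] applies there with [j = n./2 + 1]. *)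
have m_le : n./2.+1 <= n.+1 by lia.
rewrite (bigID (fun i : 'I_n.+1 => i < n./2.+1)) /=.
rewrite -(big_ord_widen _ (fun i => 'C(n, i) * (n - i.*2)) m_le) /=.
rewrite [X in _ + X]big1 ?addn0 => [|i ilt]; last first.
  have -> : n - i.*2 = 0 by lia.
  by rewrite muln0.
rewrite sum_bin_sub; last by lia.
by rewrite mul_bin_left leq_mul2r leq_subr orbT.
Qed.

(** * Members of a free family below and above a set *)

Definition members_below n (F : {set {set 'I_n}}) (X : {set 'I_n}) :=
  [set A in F | A \subset X].
Definition members_above n (F : {set {set 'I_n}}) (X : {set 'I_n}) :=
  [set A in F | X \subset A].

(** A weak copy only has to realise the relations from [A] to [B]; disjointness makes the map
    injective. *)
Lemma weak_subposet_K s t n (F A B : {set {set 'I_n}}) :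
  A \subset F -> B \subset F -> [disjoint A & B] ->
  {in A & B, forall X Y : {set 'I_n}, X \subset Y} ->
  s <= #|A| -> t <= #|B| -> weak_subposet (K s t) (family_poset F).
Proof.
move=> AF BF disj AB sA tB.
pose g (x : K s t) : {set 'I_n} := match x with
  | inl i => enum_val (widen_ord sA i)
  | inr j => enum_val (widen_ord tB j) end.
have gA i : g (inl i) \in A by apply: enum_valP.
have gB j : g (inr j) \in B by apply: enum_valP.
have gF x : g x \in F.
  by case: x => [i|j]; [apply: (subsetP AF) | apply: (subsetP BF)].
have g_neq i j : g (inl i) != g (inr j).
  by apply: contraL (gA i) => /eqP ->; rewrite (disjointFl disj).
apply/weak_subposetP; exists (fun x => Sub (g x) (gF x) : family_poset F).
  move=> x y /(congr1 val) /=.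
  case: x y => [i|i] [j|j] /eqP.
  - by move=> /eqP/enum_val_inj/(congr1 val)/= /val_inj ->.
  - by rewrite (negPf (g_neq _ _)).
  - by rewrite eq_sym (negPf (g_neq _ _)).
  - by move=> /eqP/enum_val_inj/(congr1 val)/= /val_inj ->.
move=> x y /orP[/eqP -> //|]; case: x y => [i|i] [j|j] // _.
by apply: (AB _ _ (gA i) (gB j)).
Qed.

(* The bound is [s] rather than [s.-1] because a member [X] of [F] lies both
   below and above itself. *)
Lemma members_below_or_above s t n (F : {set {set 'I_n}}) X :
  poset_free (K s t) F ->
  (#|members_below F X| <= s) || (#|members_above F X| <= t).
Proof.
apply: contraNT; rewrite negb_or -!ltnNge => /andP[lt_s lt_t].
have inD A : A \in members_below F X :\ X -> A \in F /\ A \proper X.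
  by rewrite !inE properEneq => /and3P[-> -> ->].
have inU A : A \in members_above F X -> A \in F /\ X \subset A.
  by rewrite inE => /andP.
(* [X] may lie on both sides, so it is removed from the lower one, which keeps at least [s]
   members. *)
apply: (@weak_subposet_K s t n F (members_below F X :\ X) (members_above F X)).
- by apply/subsetP => A /inD[].
- by apply/subsetP => A /inU[].
- apply/pred0P => A /=; apply/negP => /andP[/inD[_ AX] /inU[_ XA]].
  by move: AX; rewrite properE XA andbF.
- by move=> A B /inD[_ /proper_sub AX] /inU[_ XB]; apply: subset_trans XB.
- by move: lt_s; rewrite (cardsD1 X); case: (_ \in _) => //= /ltnW.
- exact: ltnW.
Qed.

(** * Splitting a chain along a family of sets *)

(** Take a largest [X] in [L] between [A] and [B]: adding any element of [B] outside [X] must leave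
    [L]. *)
Lemma boundary_edge_between n (L : {set {set 'I_n}}) (A B : {set 'I_n}) :
  A \subset B -> A \in L -> B \notin L ->
  exists2 p, p \in edge_boundary L & (A \subset p.1) && (p.2 |: p.1 \subset B).
Proof.
move=> AB AL BL.
have PA : [&& A \in L, A \subset A & A \subset B] by rewrite AL subxx.
case: (@arg_maxnP _ A [pred X : {set 'I_n} | [&& X \in L, A \subset X & X \subset B]]
  (fun X => #|X|) PA) => X /and3P[XL AX XB] maxX.
have /properP[_ [x xB xX]] : X \proper B.
  by rewrite properEneq XB andbT; apply: contraNneq BL => <-.
have xXB : x |: X \subset B by rewrite subUset sub1set xB.
exists (X, x); last by rewrite /= AX.
rewrite inE /= XL xX /=; apply/negP => xXL.
have := maxX (x |: X); rewrite /= xXL xXB (subset_trans AX (subsetUr _ _)).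
by rewrite cardsU1 xX add1n ltnn => /(_ isT).
Qed.

(** The three cases are the positions of the first member outside [L]: nowhere, at the start, or
    after a member of [L]. *)
Lemma chain_split n (L : {set {set 'I_n}}) (c : seq {set 'I_n}) :
  0 < size c -> sorted (fun A B : {set 'I_n} => A \subset B) c ->
  [\/ exists2 X, X \in L & all (fun A : {set 'I_n} => A \subset X) c,
      exists2 X, X \notin L & all (fun A : {set 'I_n} => X \subset A) c |
      exists2 p, p \in edge_boundary L &
        all (fun A : {set 'I_n} => (A \subset p.1) || (p.2 |: p.1 \subset A)) c].
Proof.
move=> c_gt0 c_sorted; set m := size c in c_gt0.
have mono i j : i <= j < m -> nth set0 c i \subset nth set0 c j.
  move=> /andP[le_ij lt_jm].
  by apply: (sorted_leq_nth _ _ set0 c_sorted) => //;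
     [move=> B A C; apply: subset_trans | rewrite inE (leq_ltn_trans le_ij)].
(* [find] returns [size c] when every member lies in [L]. *)
pose i := find (fun A => A \notin L) c.
have before j : j < i -> nth set0 c j \in L.
  by move=> /(before_find set0)/negbFE.
have [i_lt|i_ge] := ltnP i m; last first.
  apply: Or31; exists (nth set0 c m.-1); first by apply: before; lia.
  by apply/(all_nthP set0) => j lt_jm; apply: mono; lia.
have iL : nth set0 c i \notin L.
  by apply: (nth_find set0 (a := fun A => A \notin L)); rewrite has_find.
have [i0|i_gt0] := posnP i.
  apply: Or32; exists (nth set0 c i) => //.
  by apply/(all_nthP set0) => j lt_jm; apply: mono; lia.
have [||p pL /andP[Ap pB]] := boundary_edge_between _ (before i.-1 _) iL.
- by apply: mono; lia.
- by lia.
apply: Or33; exists p => //.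
apply/(all_nthP set0) => j lt_jm; have [lt_ji|le_ij] := ltnP j i.
  by rewrite (subset_trans _ Ap) //; apply: mono; lia.
by rewrite (subset_trans pB) ?orbT //; apply: mono; lia.
Qed.

(** * Counting the chains *)

Lemma ffact_le_expn n k : n ^_ k <= n ^ k.
Proof.
elim: k n => // k IH n; rewrite ffactnS expnS leq_mul2l; apply/orP; right.
by apply: leq_trans (IH _) _; case: k {IH} => // k; rewrite leq_exp2r ?leq_pred.
Qed.

Lemma card_chains_le k n (F : {set {set 'I_n}}) : #|chains k F| <= #|F| ^ k.
Proof.
apply: leq_trans (ffact_le_expn _ _); rewrite -card_uniq_tuples.
apply/subset_leq_card/subsetP => c; rewrite !inE => /andP[-> c_sorted].
apply: sorted_uniq c_sorted => [A B C|A]; [exact: proper_trans|exact: properxx].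
Qed.

Lemma card_bigcup_le (I T : finType) (P : {pred I}) (S : I -> {set T}) b :
  (forall i, P i -> #|S i| <= b) -> #|\bigcup_(i | P i) S i| <= #|P| * b.
Proof.
move=> leS; rewrite -sum_nat_const.
apply: leq_trans (leq_sum _ leS); elim/big_rec2: _ => [|i m A _ leA].
  by rewrite cards0.
by apply: leq_trans (leq_card_setU _ _) _; rewrite leq_add2l.
Qed.

Lemma card_chains_K_free s t k n (F : {set {set 'I_n}}) :
  0 < k -> poset_free (K s t) F ->
  #|chains k F| <= (2 ^ n + n * 'C(n, n./2)) * (s + t) ^ k.
Proof.
move=> k_gt0 freeF.
pose L := [set X | #|members_below F X| <= s].
have downL (X Y : {set 'I_n}) : X \subset Y -> Y \in L -> X \in L.
  rewrite !inE => XY; apply: leq_trans; apply/subset_leq_card/subsetP => A.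
  by rewrite !inE => /andP[-> /subset_trans->].
have lowL X : X \in L -> #|members_below F X| <= s by rewrite inE.
have highL X : X \notin L -> #|members_above F X| <= t.
  by have := members_below_or_above X freeF; rewrite inE; case: leqP.
(* [G X] and [H p] are the subfamilies, of at most [s + t] members, that hold the chains charged to
   a set or to an edge. *)
pose G X := if X \in L then members_below F X else members_above F X.
pose H (p : {set 'I_n} * 'I_n) :=
  members_below F p.1 :|: members_above F (p.2 |: p.1).
have cardG X : #|chains k (G X)| <= (s + t) ^ k.
  apply: leq_trans (card_chains_le _ _) _; rewrite leq_exp2r // /G.
  case: ifPn => [/lowL|/highL] /leq_trans; apply; [exact: leq_addr|exact: leq_addl].
have cardH p : p \in edge_boundary L -> #|chains k (H p)| <= (s + t) ^ k.
  rewrite inE => /and3P[pL _ pnL].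
  apply: leq_trans (card_chains_le _ _) _; rewrite leq_exp2r //.
  apply: leq_trans (leq_card_setU _ _) _.
  by rewrite leq_add ?lowL ?highL.
have cover : chains k F \subset
    (\bigcup_(X : {set 'I_n}) chains k (G X))
    :|: \bigcup_(p in edge_boundary L) chains k (H p).
  apply/subsetP => c; rewrite 2!inE => /andP[cF c_sorted].
  have c_sub : sorted (fun A B : {set 'I_n} => A \subset B) c.
    by apply: sub_sorted c_sorted => A B /proper_sub.
  have inF A : A \in val c -> A \in F by move=> /(allP cF).
  have sz : 0 < size c by rewrite size_tuple.
  apply/orP; case: (chain_split L sz c_sub) => [[X XL]|[X XL]|[p pL]] /allP cX.
  - left; apply/bigcupP; exists X => //; rewrite inE c_sorted andbT.
    by apply/allP => A Ac; rewrite /= /G XL inE inF ?cX.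
  - left; apply/bigcupP; exists X => //; rewrite inE c_sorted andbT.
    by apply/allP => A Ac; rewrite /= /G (negPf XL) inE inF ?cX.
  - right; apply/bigcupP; exists p => //; rewrite inE c_sorted andbT.
    by apply/allP => A Ac; rewrite /= !inE inF //= cX.
apply: leq_trans (subset_leq_card cover) _.
apply: leq_trans (leq_card_setU _ _) _; rewrite mulnDl leq_add //.
  apply: leq_trans (card_bigcup_le (b := (s + t) ^ k) _) _ => //.
  by rewrite -cardsT -powersetT card_powerset cardsT card_ord.
apply: leq_trans (card_bigcup_le cardH) _.
by rewrite leq_mul2r edge_boundary_down_set ?orbT.
Qed.

Lemma La_chain_K_le s t k n : 0 < k -> 0 < n ->
  La_chain n (K s t) k <= 3 * (s + t) ^ k * (n * 'C(n, n./2)).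
Proof.
move=> k_gt0 n_gt0; apply/bigmax_leqP => F /(card_chains_K_free k_gt0).
move=> /leq_trans; apply; rewrite -mulnAC leq_mul2r; apply/orP; right.
(* As [n >= 1], [2 ^ n <= (n+1) 'C(n, n./2) <= 2 n 'C(n, n./2)]; the edge term makes the constant
   3. *)
by have := expn2_le_bin_half n; nia.
Qed.

(* The asymptotic bounds over the reals *)
From mathcomp Require Import all_algebra.
From mathcomp Require Import all_classical all_reals all_analysis.
Import Order.TTheory GRing.Theory Num.Theory.
Import numFieldNormedType.Exports.
Local Open Scope classical_set_scope.
Local Open Scope ring_scope.

Theorem theorem4 (R : realType) (s t k : nat)
    (hs : (2 <= s)%N) (ht : (2 <= t)%N) (hk : (1 <= k)%N) :
  let La := (fun n : nat => ((La_chain n (K s t) k)%:R : R) : R^o) in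
  let central := (fun n : nat => (n%:R * 'C(n, n./2)%:R : R) : R^o) in
  let root := (fun n : nat => (Num.sqrt n%:R * 2 ^+ n : R) : R^o) in
  [/\ La =O_\oo central, central =O_\oo root & La =O_\oo root].
Proof.
move=> La central root.
have La_central : La =O_\oo central.
  apply/eqO_exP; exists (3 * (s + t) ^ k)%N%:R.
    by rewrite ltr0n muln_gt0 expn_gt0 addn_gt0 (ltnW hs).
  exists 1%N => // n /= n_gt0; rewrite /La /central !ger0_norm ?mulr_ge0 //.
  by rewrite -!natrM ler_nat La_chain_K_le.
have central_root : central =O_\oo root.
  apply/eqO_exP; exists 1 => //; exists 0%N => // n _.
  rewrite mul1r /central /root !ger0_norm ?mulr_ge0 ?sqrtr_ge0 ?exprn_ge0 //.
  (* Write [n] as [sqrt n * sqrt n] and cancel one factor; the remaining inequality is compared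
     through squares. *)
  rewrite -{1}(sqr_sqrtr (ler0n R n)) expr2 -mulrA ler_wpM2l ?sqrtr_ge0 //.
  rewrite -(@ler_pXn2r _ 2) ?nnegrE ?mulr_ge0 ?sqrtr_ge0 ?exprn_ge0 //.
  by rewrite exprMn sqr_sqrtr // -!natrX -natrM ler_nat bin_half_sqr_le.
by split => //; apply: eqO_trans La_central central_root.
Qed.
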